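(* Let $-1\le q\le 1$, $\theta\in\mathbb R$, $\tau\ge 0$. Let $(X_t)_{t\ge0}$ be the Markov process with $X_0=0$ and transition probabilities $P_{s,t}(x,dy)=\mu_{x,s,t,q,\theta,\tau}(dy)$, $0\le s<t$, where $\mu_{x,s,t,q,\theta,\tau}$ is the measure defined in the context. Let $p_n(x,t)$ be the polynomials defined by $p_{-1}=0$, $p_0=1$, $p_1(x,t)=x$ and $$x\,p_n(x,t)=p_{n+1}(x,t)+\theta[n]_q\,p_n(x,t)+(t+\tau[n-1]_q)[n]_q\,p_{n-1}(x,t),\quad n\ge1.$$ Then for all $t>s\ge0$ and all $n\ge 0$, $$E\big(p_n(X_t,t)\mid\mathcal F_{\le s}\big)=p_n(X_s,s).$$
   Context: Notation: $\mathcal F_{\le s}=\sigma(X_r:0\le r\le s)$. For real $q$, $[n]_q=1+q+\dots+q^{n-1}$, $[0]_q=0$ (and $q^0=1$). For real parameters $x,s,t,q,\theta,\tau$ the polynomials $Q_n(y)=Q_n(y|x,s,t)$ in $y$ are defined by $Q_0=1$, $Q_1(y)=y-x$, and for $n\ge1$ $$yQ_n(y)=Q_{n+1}(y)+(\theta[n]_q+xq^n)Q_n(y)+(t-sq^{n-1}+\tau[n-1]_q)[n]_q\,Q_{n-1}(y).$$ For $x,\theta\in\mathbb R$, $0\le s<t$, $\tau\ge0$, $-1\le q\le1$, $\mu_{x,s,t}=\mu_{x,s,t,q,\theta,\tau}$ denotes the unique probability measure on $\mathbb R$ (with finite moments of all orders) with respect to which the polynomials $Q_n(\cdot|x,s,t)$,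 $n\ge0$, are orthogonal, i.e. $\int Q_nQ_m\,d\mu_{x,s,t}=0$ for $n\ne m$. One has $p_n(x,t)=Q_n(x|0,0,t)$. *)

(* Defs.v *)
From HB Require Import structures.
From mathcomp Require Import all_boot all_order all_algebra.
From mathcomp Require Import all_classical all_reals all_analysis.

Set Implicit Arguments.
Unset Strict Implicit.
Unset Printing Implicit Defensive.

Import Order.TTheory GRing.Theory Num.Theory.
Import numFieldNormedType.Exports.

Local Open Scope classical_set_scope.
Local Open Scope ring_scope.

Section polynomials.
Variable R : realType.

Definition qnum (q : R) (n : nat) : R := \sum_(i < n) q ^+ i.

(* The three-term recurrence at rank n = m.+1 >= 1, solved for Q_(n+1). *)
Fixpoint Qpoly (q theta tau x s t : R) (n : nat) : {poly R} :=
  match n with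
  | 0 => 1
  | 1 => 'X - x%:P
  | ((m.+1) as n').+1 =>
      'X * Qpoly q theta tau x s t n'
      - (theta * qnum q n' + x * q ^+ n') *: Qpoly q theta tau x s t n'
      - ((t - s * q ^+ m + tau * qnum q m) * qnum q n')
          *: Qpoly q theta tau x s t m
  end.

(* p_n(x, t) is (ppoly q theta tau t n).[x]. *)
Fixpoint ppoly (q theta tau t : R) (n : nat) : {poly R} :=
  match n with
  | 0 => 1
  | 1 => 'X
  | ((m.+1) as n').+1 =>
      'X * ppoly q theta tau t n'
      - (theta * qnum q n') *: ppoly q theta tau t n'
      - ((t + tau * qnum q m) * qnum q n') *: ppoly q theta tau t m
  end.

(* m is the measure mu_(x,s,t,q,theta,tau). *)
Definition is_mu (q theta tau x s t : R)
    (m : {measure set (measurableTypeR R) -> \bar R}) : Prop :=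
  [/\ m [set: R] = 1%E,
      forall n : nat, m.-integrable [set: R] (fun y : R => (y ^+ n)%:E) &
      forall n k : nat, n <> k ->
        (\int[m]_(y in [set: R])
           ((Qpoly q theta tau x s t n).[y]
            * (Qpoly q theta tau x s t k).[y])%:E = 0)%E].

End polynomials.

Section processes.
Variables (d : measure_display) (Omega : measurableType d) (R : realType).
Variable P : probability Omega R.

(* Y is a version of E(Z | G). *)
Definition is_cond_expectation (G : set (set Omega)) (Z Y : Omega -> R)
    : Prop :=
  [/\ P.-integrable [set: Omega] (EFin \o Z),
      P.-integrable [set: Omega] (EFin \o Y),
      forall B : set (measurableTypeR R), measurable B -> G (Y @^-1` B) &
      forall A : set Omega, G A ->
        (\int[P]_(w in A) (Y w)%:E = \int[P]_(w in A) (Z w)%:E)%E].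

(* Processes are indexed by all of R, but only the times r >= 0 matter. *)
Definition past (X : R -> {RV P >-> R}) (s : R) : set (set Omega) :=
  <<s [set A | exists r : R, exists B : set (measurableTypeR R),
         [/\ 0 <= r <= s, measurable B & A = X r @^-1` B]] >>.

Definition markov_process (X : R -> {RV P >-> R})
    (K : R -> R -> R.-pker (measurableTypeR R) ~> (measurableTypeR R))
    : Prop :=
  forall (s t : R) (B : set (measurableTypeR R)),
    0 <= s -> s < t -> measurable B ->
    is_cond_expectation (past X s)
      (\1_(X t @^-1` B)) (fun w => fine (K s t (X s w) B)).

End processes.

(* Main.v *)
Require Import Defs.
From HB Require Import structures.
From mathcomp Require Import all_boot all_order all_algebra.
From mathcomp Require Import all_classical all_reals all_analysis.
From mathcomp Require Import measurable_realfun ring.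
Import Order.TTheory GRing.Theory Num.Theory.
Import numFieldNormedType.Exports.
Local Open Scope classical_set_scope.
Local Open Scope ring_scope.

(** The heart of the matter is the connection formula [ppoly_Qpoly]
      p_n(y, t) = sum_(k <= n) [n choose k]_q p_(n-k)(x, s) Q_k(y | x, s, t),
    an identity between polynomials in y, valid for all real values of the
    parameters.  Its coefficients do not involve t.  Expanding
    y p_n(y, t) in the Q_k and comparing the coefficients of Q_k, the part
    proportional to t vanishes because [k+1] [n, k+1] = [n] [n-1, k], and what
    remains is q^k [n, k] times the three-term recurrence of p at (x, s).

    Integrate this formula against mu_(x,s,t).  As Q_0 = 1, orthogonality kills
    every term with k > 0, and the integral of p_n(., t) is p_n(x, s)
    ([integral_ppoly]).

    It remains to pass from the Markov property, which speaks of indicators, to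
    polynomials.  Over a set A of the past of time s, the average of f(X_t) is
    that of the integral of f against the transition kernel at X_s: this holds
    for nonnegative f by approximation by simple functions, and for every f such
    that f(X_t) is integrable by splitting f into positive and negative parts
    ([integral_comp_kernel]).  Finally every polynomial in X_t is integrable
    ([integrable_horner_process]): since X_0 = 0 almost surely, the law of X_t
    is mu_(0,0,t) for t > 0, and it has moments of all orders. *)

Set Implicit Arguments.
Unset Strict Implicit.
Unset Printing Implicit Defensive.

(** * Gaussian binomial coefficients *)

Section qnumbers.
Variables (R : realType) (q : R).

Lemma qnum0 : qnum q 0 = 0.
Proof. by rewrite /qnum big_ord0. Qed.

Lemma qnumS n : qnum q n.+1 = qnum q n + q ^+ n.
Proof. by rewrite /qnum big_ord_recr. Qed.

Lemma qnumD m n : qnum q (m + n) = qnum q m + q ^+ m * qnum q n.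
Proof.
elim: n => [|n IHn]; first by rewrite addn0 qnum0 mulr0 addr0.
by rewrite addnS !qnumS IHn mulrDr exprD addrA.
Qed.

(** The Gaussian binomial coefficient.  It is defined by the q-Pascal rule
    rather than as a quotient of q-factorials, because [n]_q may vanish (for
    instance [2]_q = 0 when q = -1). *)
Fixpoint qbinom (n k : nat) : R :=
  match n, k with
  | _, 0 => 1
  | 0, _.+1 => 0
  | n'.+1, k'.+1 => qbinom n' k' + q ^+ k * qbinom n' k
  end.

Lemma qbinom0 n : qbinom n 0 = 1.
Proof. by case: n. Qed.

Lemma qbinomS n k :
  qbinom n.+1 k =
  (if k is j.+1 then qbinom n j else 0) + q ^+ k * qbinom n k.
Proof. by case: k => [|k] //=; rewrite qbinom0 expr0 mulr1 add0r. Qed.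

Lemma qbinom_small n k : (n < k)%N -> qbinom n k = 0.
Proof.
elim: n k => [|n IHn] [|k] //; rewrite ltnS => ltnk.
by rewrite qbinomS !IHn ?mulr0 ?addr0// ltnW.
Qed.

Lemma qbinomnn n : qbinom n n = 1.
Proof.
elim: n => [//|n IHn].
by rewrite qbinomS IHn qbinom_small// mulr0 addr0.
Qed.

Lemma mul_qnum_qbinom_next n k :
  (k <= n)%N -> qnum q k.+1 * qbinom n k.+1 = qnum q (n - k) * qbinom n k.
Proof.
elim: n k => [|n IHn] k.
  by rewrite leqn0 => /eqP ->; rewrite subn0 qnum0 qbinom_small// mulr0 mul0r.
rewrite leq_eqVlt => /predU1P[->|]; last rewrite ltnS => lekn.
  by rewrite subnn qnum0 qbinom_small// mulr0 mul0r.
have -> : qnum q k.+1 * qbinom n.+1 k.+1 = qnum q n.+1 * qbinom n k.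
  rewrite qbinomS mulrDr mulrCA IHn// mulrA -mulrDl -qnumD.
  by rewrite addSn subnKC.
case: k lekn => [|k] lekn; first by rewrite subn0 !qbinom0.
rewrite qbinomS subSS mulrDr -IHn; last exact: ltnW.
by rewrite mulrCA mulrA -mulrDl -qnumD -{1}(subnKC lekn) addSn -addnS subnSK.
Qed.

Lemma mul_qnum_qbinomS n k : (k <= n)%N ->
  qnum q k.+1 * qbinom n.+1 k.+1 = qnum q n.+1 * qbinom n k.
Proof.
move=> lekn; rewrite qbinomS mulrDr mulrCA mul_qnum_qbinom_next// mulrA.
by rewrite -mulrDl -qnumD addSn subnKC.
Qed.

Lemma mul_qnum_qbinom_sub n k : (k <= n)%N ->
  qnum q (n.+1 - k) * qbinom n.+1 k = qnum q n.+1 * qbinom n k.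
Proof.
move=> lekn; rewrite -mul_qnum_qbinom_next ?mul_qnum_qbinomS//.
exact: leqW.
Qed.

End qnumbers.

(** * Connection between the two families of polynomials *)

Section connection.
Variables (R : realType) (q theta tau x s t : R).
Local Notation Q := (Qpoly q theta tau x s t).
Local Notation p := (ppoly q theta tau).

Lemma Qpoly0 : Q 0 = 1. Proof. by []. Qed.

Lemma ppolySS u m : p u m.+2 =
  'X * p u m.+1 - (theta * qnum q m.+1) *: p u m.+1
  - ((u + tau * qnum q m) * qnum q m.+1) *: p u m.
Proof. by []. Qed.

Lemma mulX_Qpoly k : 'X * Q k =
  Q k.+1 + (theta * qnum q k + x * q ^+ k) *: Q k
  + (if k is j.+1
     then ((t - s * q ^+ j + tau * qnum q j) * qnum q k) *: Q j else 0).
Proof.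
case: k => [|k] /=; last by rewrite addrAC !addrNK.
by rewrite qnum0 mulr0 add0r mulr1 addr0 -mul_polyC !mulr1 addrNK.
Qed.

(** Multiplication by the variable, in coordinates with respect to the Q_k. *)
Lemma mulX_sum_Qpoly (c : nat -> R) N : (forall k, (N <= k)%N -> c k = 0) ->
  'X * \sum_(k < N) c k *: Q k =
  \sum_(k < N.+1) ((if (k : nat) is j.+1 then c j else 0)
    + (theta * qnum q k + x * q ^+ k) * c k
    + (t - s * q ^+ k + tau * qnum q k) * (qnum q k.+1 * c k.+1)) *: Q k.
Proof.
move=> c0.
under [RHS]eq_bigr do rewrite !scalerDl.
rewrite !big_split /= mulr_sumr.
under [LHS]eq_bigr do rewrite -scalerAr mulX_Qpoly !scalerDr.
rewrite !big_split /=; congr (_ + _ + _).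
- by rewrite big_ord_recl scale0r add0r.
- rewrite big_ord_recr /= c0// mulr0 scale0r addr0.
  by apply: eq_bigr => k _; rewrite scalerA mulrC.
- rewrite big_ord_recr /= c0// !mulr0 scale0r addr0.
  case: N c0 => [|N] c0; first by rewrite !big_ord0.
  rewrite big_ord_recl /= scaler0 add0r [RHS]big_ord_recr /= c0//.
  rewrite !mulr0 scale0r addr0.
  by apply: eq_bigr => k _; rewrite scalerA mulrC mulrA.
Qed.

(** The coordinate of p_n(., t) along Q_k(. | x, s, t); it vanishes for k > n,
    where the truncated difference [n - k] plays no role. *)
Definition connection_coef n k := qbinom q n k * (p s (n - k)).[x].
Local Notation c := connection_coef.

Lemma connection_coef_small n k : (n < k)%N -> c n k = 0.
Proof. by move=> nk; rewrite /c qbinom_small// mul0r. Qed.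

Lemma sum_connection_coef_widen n N : (n < N)%N ->
  \sum_(k < N) c n k *: Q k = \sum_(k < n.+1) c n k *: Q k.
Proof.
move=> ltnN.
rewrite (big_ord_widen _ (fun k => c n k *: Q k) ltnN) [RHS]big_mkcond.
apply: eq_bigr => k _; case: ifPn => //; rewrite ltnS -ltnNge => nk.
by rewrite connection_coef_small// scale0r.
Qed.

(** The recurrence of the polynomials p_n(., t), read off the coefficient of
    Q_k. *)
Lemma connection_coef_rec m k : (k < m.+3)%N ->
  c m.+2 k = (if k is j.+1 then c m.+1 j else 0)
    + (theta * qnum q k + x * q ^+ k) * c m.+1 k
    + (t - s * q ^+ k + tau * qnum q k) * (qnum q k.+1 * c m.+1 k.+1)
    - theta * qnum q m.+1 * c m.+1 k
    - (t + tau * qnum q m) * qnum q m.+1 * c m k.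
Proof.
have -> : (if k is j.+1 then c m.+1 j else 0) =
    (if k is j.+1 then qbinom q m.+1 j else 0) * (p s (m.+2 - k)).[x].
  by case: k => [|k]; rewrite ?mul0r.
rewrite {1}/c qbinomS; set B := (if k is j.+1 then _ else _).
rewrite !ltnS leq_eqVlt => /predU1P[->|].
  by rewrite !connection_coef_small// qbinom_small// subnn /= hornerC; ring.
rewrite ltnS leq_eqVlt => /predU1P[->|].
  rewrite !(@connection_coef_small _ m.+2)// (@connection_coef_small m)//.
  by rewrite /c qbinomnn subnn subSnn /= hornerC hornerX; ring.
rewrite ltnS => lekm; have [i mE] : exists i, m = (k + i)%N.
  by exists (m - k)%N; rewrite subnKC.
have ik1 : (m.+1 - k = i.+1)%N by rewrite mE -addnS addKn.
have ik2 : (m.+2 - k = i.+2)%N by rewrite mE -!addnS addKn.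
have ik : (m - k = i)%N by rewrite mE addKn.
have qb_next := mul_qnum_qbinomS q lekm.
have qb_sub := mul_qnum_qbinom_sub q lekm.
rewrite ik1 in qb_sub.
(* By E1 and E2 below, t occurs with opposite coefficients in the two terms
   that contain it. *)
have E1 : qnum q k.+1 * c m.+1 k.+1 =
    qnum q i.+1 * qbinom q m.+1 k * (p s i).[x].
  by rewrite /c subSS ik mulrA qb_next -qb_sub.
have E2 : qnum q m.+1 * c m k = qnum q i.+1 * qbinom q m.+1 k * (p s i).[x].
  by rewrite /c ik mulrA -qb_sub.
rewrite E1 -[(t + _) * _ * _]mulrA E2 /c ik1 ik2.
have -> : (p s i.+2).[x] =
    x * (p s i.+1).[x] - theta * qnum q i.+1 * (p s i.+1).[x]
    - (s + tau * qnum q i) * qnum q i.+1 * (p s i).[x].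
  by rewrite ppolySS !hornerE.
have -> : qnum q m.+1 = qnum q k + q ^+ k * qnum q i.+1.
  by rewrite -qnumD mE addnS.
have -> : qnum q m = qnum q k + q ^+ k * qnum q i by rewrite -qnumD mE.
ring.
Qed.

Lemma ppoly_Qpoly n : p t n = \sum_(k < n.+1) c n k *: Q k.
Proof.
suff: p t n = \sum_(k < n.+1) c n k *: Q k /\
      p t n.+1 = \sum_(k < n.+2) c n.+1 k *: Q k by case.
elim: n => [|m [IH0 IH1]].
  rewrite !big_ord_recr !big_ord0 /c /= !hornerE.
  by rewrite !scale1r -mul_polyC mulr1 addrC addrNK.
split=> //.
rewrite ppolySS IH0 IH1 mulX_sum_Qpoly; last exact: connection_coef_small.
rewrite -(@sum_connection_coef_widen m m.+3)//; last exact: leqW.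
rewrite -(@sum_connection_coef_widen m.+1 m.+3)// !scaler_sumr -!sumrB.
by apply: eq_bigr => k _; rewrite connection_coef_rec// !scalerBl !scalerA.
Qed.

End connection.

(** * Integration against the orthogonality measure *)

Lemma integrable_horner (R : realType)
    (m : {measure set (measurableTypeR R) -> \bar R}) (p : {poly R}) :
  (forall n : nat, m.-integrable [set: R] (fun y : R => (y ^+ n)%:E)) ->
  m.-integrable [set: R] (fun y => p.[y]%:E).
Proof.
move=> moments; under eq_fun do rewrite horner_coef -sumEFin.
apply: integrable_sum => // i _.
under eq_fun do rewrite EFinM.
exact: integrableZl.
Qed.

Lemma integral_ppoly (R : realType) (q theta tau x s t : R)
    (m : {measure set (measurableTypeR R) -> \bar R}) n :
  is_mu q theta tau x s t m ->
  (\int[m]_(y in [set: R]) (ppoly q theta tau t n).[y]%:E =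
   (ppoly q theta tau s n).[x]%:E)%E.
Proof.
move=> [m1 moments orth].
have intQ k : (\int[m]_(y in [set: R]) (Qpoly q theta tau x s t k).[y]%:E =
    (k == 0)%:R%:E)%E.
  case: k => [|k].
    under eq_integral do rewrite Qpoly0 hornerC.
    by rewrite integral_cst// mul1e m1.
  rewrite -[RHS](orth k.+1 0%N)//; apply: eq_integral => y _.
  by rewrite Qpoly0 hornerC mulr1.
under eq_integral do rewrite (ppoly_Qpoly _ _ _ x s) horner_sum -sumEFin.
rewrite integral_sum//; last by move=> k; exact: integrable_horner.
under eq_bigr => k _.
  under eq_integral do rewrite hornerZ EFinM.
  rewrite integralZl//; last exact: integrable_horner.
  rewrite intQ -EFinM.
  over.
rewrite big_ord_recl big1 => [|k _]; last by rewrite mulr0.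
by rewrite /= /connection_coef qbinom0 subn0 mul1r mulr1 adde0.
Qed.

(** * Integration against a mixture of measures *)

Section disintegration.
Context d1 d2 (T1 : measurableType d1) (T2 : measurableType d2) (R : realType).
Variables (mu : {measure set T1 -> \bar R}) (nu : {measure set T2 -> \bar R}).
Variables (D : set T1) (k : T1 -> {measure set T2 -> \bar R}).
Hypothesis mD : measurable D.
Hypothesis mk : forall U, measurable U -> measurable_fun [set: T1] (k ^~ U).
Hypothesis nuE : forall U, measurable U -> nu U = (\int[mu]_(x in D) k x U)%E.
Import HBNNSimple.
Local Open Scope ereal_scope.

Let disintegration_nnsfun (h : {nnsfun T2 >-> R}) :
  \int[nu]_y (h y)%:E = \int[mu]_(x in D) \int[k x]_y (h y)%:E.
Proof.
under [RHS]eq_integral do rewrite integralT_nnsfun sintegralE.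
rewrite integralT_nnsfun sintegralE ge0_integral_fsum//; first last.
- by move=> r x _; exact: nnsfun_mulemu_ge0.
- by move=> r; apply: measurable_funeM; apply: measurable_funTS; exact: mk.
apply: eq_fsbigr => r _; rewrite nuE//.
have [r0|r0] := leP 0%R r.
  by rewrite ge0_integralZl//; apply: measurable_funTS; exact: mk.
rewrite preimage_nnfun0//.
by under [RHS]eq_integral do rewrite measure0 mule0;
   under eq_integral do rewrite measure0; rewrite !integral0 mule0.
Qed.

(** If [nu] is the mixture of the measures [k x] for x in [D], weighted by [mu],
    then so is its action on nonnegative functions. *)
Lemma ge0_integral_disintegration (f : T2 -> \bar R) :
  (forall y, 0 <= f y) -> measurable_fun [set: T2] f ->
  \int[nu]_y f y = \int[mu]_(x in D) \int[k x]_y f y.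
Proof.
move=> f0 mf; pose f_ := nnsfun_approx measurableT mf.
have mf_ n : measurable_fun [set: T2] (EFin \o f_ n) by exact/measurable_EFinP.
have f_0 n y : 0 <= (EFin \o f_ n) y by rewrite lee_fin.
have nd_f_ y : {homo (fun n => (EFin \o f_ n) y) : a b / (a <= b)%N >-> a <= b}.
  by move=> a b ab; rewrite lee_fin; exact/lefP/nd_nnsfun_approx.
have limf_ (m : {measure set T2 -> \bar R}) :
    \int[m]_y f y = limn (fun n => \int[m]_y (f_ n y)%:E).
  rewrite -monotone_convergence//.
  - apply: eq_integral => y _; apply/esym/cvg_lim => //.
    exact: cvg_nnsfun_approx.
  - by move=> n y _; exact: f_0.
  - by move=> y _; exact: nd_f_.
rewrite limf_; under [RHS]eq_integral do rewrite limf_.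
rewrite monotone_convergence//.
- by congr (limn _); apply/funext => n; exact: disintegration_nnsfun.
- move=> n; apply: measurable_funTS.
  exact: (measurable_fun_integral_kernel mk (f_0 n) (mf_ n)).
- by move=> n x _; apply: integral_ge0 => y _; exact: f_0.
- move=> x _ a b ab; apply: ge0_le_integral; rewrite ?measurableT//.
  + by move=> y _; exact: f_0.
  + exact: mf_.
  + exact: mf_.
  + by move=> y _; exact: nd_f_.
Qed.

End disintegration.

Section comp_kernel.
Context d1 d2 (T1 : measurableType d1) (T2 : measurableType d2) (R : realType).
Variables (mu : {measure set T1 -> \bar R}) (Y : T1 -> T2).
Variables (A : set T1) (k : T1 -> {measure set T2 -> \bar R}).
Hypothesis mY : measurable_fun [set: T1] Y.
Hypothesis mA : measurable A.
Hypothesis mk : forall U, measurable U -> measurable_fun [set: T1] (k ^~ U).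
Hypothesis muE : forall U, measurable U ->
  mu (A `&` Y @^-1` U) = (\int[mu]_(x in A) k x U)%E.
Local Open Scope ereal_scope.

(** The hypotheses say that, as far as averages over the single set [A] are
    concerned, [k] is a version of the conditional law of [Y]. *)
Lemma ge0_integral_comp_kernel (f : T2 -> \bar R) :
  measurable_fun [set: T2] f -> (forall y, 0 <= f y) ->
  \int[mu]_(x in A) f (Y x) = \int[mu]_(x in A) \int[k x]_y f y.
Proof.
move=> mf f0.
(* The image by Y of the restriction of mu to A is a mixture in two ways: of
   the measures k x, and of the Dirac measures at Y x. *)
pose push : {measure set T2 -> \bar R} := pushforward (mrestr mu mA) Y.
pose nu := push mY.
have nuE U : measurable U -> nu U = mu (A `&` Y @^-1` U).
  by move=> mU; rewrite /nu /push/= /pushforward /mrestr setIC.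
have nuk U : measurable U -> nu U = \int[mu]_(x in A) k x U.
  by move=> mU; rewrite nuE// muE.
pose delta x : {measure set T2 -> \bar R} := \d_(Y x).
have mdelta U : measurable U -> measurable_fun [set: T1] (delta ^~ U).
  move=> mU; rewrite (_ : delta ^~ U = EFin \o (\1_U \o Y))//.
  by apply/measurable_EFinP/measurableT_comp; first exact: measurable_indic.
have nudelta U : measurable U -> nu U = \int[mu]_(x in A) delta x U.
  move=> mU; rewrite nuE// setIC -integral_indic//.
  by rewrite -[X in measurable X]setTI; exact: mY.
rewrite -(ge0_integral_disintegration mA mk nuk)//.
rewrite (ge0_integral_disintegration mA mdelta nudelta)//.
by apply: eq_integral => x _; rewrite integral_dirac// diracT mul1e.
Qed.

Lemma integral_comp_kernel (f : T2 -> \bar R) :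
  measurable_fun [set: T2] f -> mu.-integrable A (f \o Y) ->
  \int[mu]_(x in A) f (Y x) = \int[mu]_(x in A) \int[k x]_y f y.
Proof.
move=> mf intf.
have intk g : measurable_fun [set: T2] g -> (forall y, 0 <= g y) ->
    mu.-integrable A (g \o Y) -> mu.-integrable A (fun x => \int[k x]_y g y).
  move=> mg g0 /integrableP[_ gfin]; apply/integrableP; split.
    by apply: measurable_funTS; exact: measurable_fun_integral_kernel.
  under eq_integral do rewrite gee0_abs ?integral_ge0//.
  rewrite -ge0_integral_comp_kernel//; apply: le_lt_trans gfin.
  by under [leRHS]eq_integral do rewrite /= gee0_abs//.
rewrite -[LHS]/(\int[mu]_(x in A) (f \o Y) x) integralE.
rewrite funepos_comp funeneg_comp.
rewrite !ge0_integral_comp_kernel//;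
  [|exact: measurable_funeneg|exact: measurable_funepos].
rewrite -integralB//.
- by apply: eq_integral => x _; rewrite [RHS]integralE.
- apply: intk => //; first exact: measurable_funepos.
  by rewrite -funepos_comp; exact: integrable_funepos.
- apply: intk => //; first exact: measurable_funeneg.
  by rewrite -funeneg_comp; exact: integrable_funeneg.
Qed.

End comp_kernel.

(** * Polynomials of the Markov process *)

Section markov.
Context (R : realType) (d : measure_display) (Omega : measurableType d).
Variables (P : probability Omega R) (X : R -> {RV P >-> R}).

Lemma past_measurable s A : past X s A -> measurable A.
Proof.
apply: smallest_sub; first exact: sigma_algebra_measurable.
move=> _ [r [B [_ mB ->]]].
by rewrite -[X in measurable X]setTI; exact: measurable_funPT.
Qed.

Lemma past_preimage r s B : 0 <= r <= s -> measurable B ->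
  past X s (X r @^-1` B).
Proof. by move=> rs mB; apply: sub_gen_smallest; exists r, B. Qed.

Variable K : R -> R -> R.-pker (measurableTypeR R) ~> (measurableTypeR R).
Hypothesis hX : markov_process X K.

Lemma markov_kernel s t A B : 0 <= s -> s < t -> past X s A -> measurable B ->
  P (A `&` X t @^-1` B) = (\int[P]_(w in A) K s t (X s w) B)%E.
Proof.
move=> s0 st pA mB; have [_ _ _ /(_ A pA) KE] := hX s0 st mB.
have mA := past_measurable pA.
have mXB : measurable (X t @^-1` B).
  by rewrite -[X in measurable X]setTI; exact: measurable_funPT.
rewrite setIC -integral_indic// -KE.
apply: eq_integral => w _; rewrite fineK// ge0_fin_numE//.
apply: (@le_lt_trans _ _ (K s t (X s w) setT)).
  by rewrite le_measure ?inE.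
by rewrite prob_kernel ltry.
Qed.

Variables q theta tau : R.
Hypothesis hK : forall x s t : R, 0 <= s -> s < t ->
  is_mu q theta tau x s t (K s t x).
Hypothesis hX0 : {ae P, forall w, X 0 w = 0}.

Lemma integrable_horner_process t (p : {poly R}) : 0 <= t ->
  P.-integrable [set: Omega] (fun w => p.[X t w]%:E).
Proof.
have mp : measurable_fun [set: measurableTypeR R] (fun y : R => p.[y]%:E).
  apply/measurable_EFinP; apply: continuous_measurable_fun.
  exact: continuous_horner.
have mpX u : measurable_fun [set: Omega] (fun w => p.[X u w]%:E).
  exact: (measurableT_comp mp (measurable_funPT (X u))).
rewrite le_eqVlt => /predU1P[<-|t0].
  apply/integrableP; split; first exact: mpX.
  rewrite (ae_eq_integral (cst `|p.[0]%:E|%E))//.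
  - by rewrite integral_cst//= probability_setT mule1 ltry.
  - exact: (measurableT_comp (@abse_measurable _ _) (mpX 0)).
  - by apply: filterS hX0 => w Xw _; rewrite Xw.
have [_ mom _] := hK 0 (lexx 0) t0.
have mabs :
    measurable_fun [set: measurableTypeR R] (fun y : R => `|p.[y]%:E|%E).
  exact: (measurableT_comp (@abse_measurable _ _) mp).
have mK B : measurable B ->
    measurable_fun [set: Omega] (fun w => K 0 t (X 0 w) B).
  move=> mB; have mX := measurable_funPT (X 0).
  exact: (measurableT_comp (measurable_kernel (K 0 t) B mB) mX).
apply/integrableP; split; first exact: mpX.
(* The target type is given explicitly: the canonical measurable structure on R
   is another one, with the same measurable sets. *)
rewrite (@ge0_integral_comp_kernel _ _ Omega (measurableTypeR R) R P (X t) setT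
  (fun w => K 0 t (X 0 w)) (measurable_funPT (X t)) measurableT mK _
  (fun y => `|p.[y]%:E|%E))//; last first.
  move=> B mB; apply: (markov_kernel (lexx 0) t0 _ mB).
  by rewrite -(@preimage_setT _ _ (X 0)); apply: past_preimage; rewrite ?lexx.
(* Almost surely X 0 = 0, so the inner integral is the one for the law
   started at 0, which has moments of all orders. *)
rewrite (ae_eq_integral (cst (\int[K 0%R t 0%R]_y `|p.[y]%:E|)%E))//.
- rewrite integral_cst//= probability_setT mule1.
  by have /integrableP[] := integrable_horner p mom.
- exact: measurable_fun_integral_kernel.
- by apply: filterS hX0 => w Xw _; rewrite Xw.
Qed.

End markov.

Theorem proposition3p3 (R : realType) (q theta tau : R)
  (hq : -1 <= q <= 1) (htau : 0 <= tau)
  (d : measure_display) (Omega : measurableType d) (P : probability Omega R)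
  (X : R -> {RV P >-> R})
  (K : R -> R -> R.-pker (measurableTypeR R) ~> (measurableTypeR R))
  (hK : forall x s t : R, 0 <= s -> s < t ->
          is_mu q theta tau x s t (K s t x))
  (hX0 : {ae P, forall w, X 0 w = 0})
  (hX : markov_process X K) :
  forall (s t : R) (n : nat), 0 <= s -> s < t ->
    is_cond_expectation P (past X s)
      (fun w => (ppoly q theta tau t n).[X t w])
      (fun w => (ppoly q theta tau s n).[X s w]).
Proof.
move=> s t n s0 st; have t0 := ltW (le_lt_trans s0 st).
have mh p : measurable_fun [set: measurableTypeR R] (fun y : R => p.[y]).
  by apply: continuous_measurable_fun; exact: continuous_horner.
split.
- exact: (integrable_horner_process hX hK hX0).
- exact: (integrable_horner_process hX hK hX0).
- move=> B mB; rewrite (_ : _ @^-1` B =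
    X s @^-1` ((fun y => (ppoly q theta tau s n).[y]) @^-1` B))//.
  apply: past_preimage; first by rewrite s0 lexx.
  by rewrite -[X in measurable X]setTI; exact: mh.
- move=> A pA; have mA := past_measurable pA.
  rewrite (@integral_comp_kernel _ _ Omega (measurableTypeR R) R P (X t) A
     (fun w => K s t (X s w)) (measurable_funPT (X t)) mA _ _
     (fun y => (ppoly q theta tau t n).[y]%:E)).
  + by apply: eq_integral => w _; rewrite (integral_ppoly _ (hK _ _ _ s0 st)).
  + move=> U mU; have mX := measurable_funPT (X s).
    exact: (measurableT_comp (measurable_kernel (K s t) U mU) mX).
  + by move=> U mU; exact: markov_kernel.
  + exact/measurable_EFinP.
  + exact: integrableS (integrable_horner_process hX hK hX0 _ t0).
Qed.
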